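(* For every $n\in\mathbb{N}$, $F(n)\le\sqrt{n+1}$, and equality holds if and only if $n=f_r^2-1$ for some $r\in\mathbb{N}$.
   Context: $f_0=f_1=1$, $f_i=f_{i-1}+f_{i-2}$ ($i\ge2$). A Fibonacci partition of $n\in\mathbb{N}$ is a finite set $\{f_{i_1},\dots,f_{i_h}\}$ with $1\le i_1<\dots<i_h$ and $f_{i_1}+\dots+f_{i_h}=n$ (the empty set for $n=0$); $F(n)$ is the number of Fibonacci partitions of $n$, i.e. $\prod_{i\ge1}(1+x^{f_i})=\sum_{n\ge0}F(n)x^n$. *)

(* Defs.v *)
From HB Require Import structures.
From mathcomp Require Import all_boot all_order all_algebra finmap.

Set Implicit Arguments.
Unset Strict Implicit.
Unset Printing Implicit Defensive.

Local Open Scope fset_scope.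
Local Open Scope nat_scope.


Fixpoint fib (n : nat) : nat :=
  match n with
  | 0 => 1
  | 1 => 1
  | (m.+1 as k).+1 => fib k + fib m
  end.

Lemma fibSS i : fib i.+2 = fib i.+1 + fib i.
Proof. by []. Qed.

Lemma fib_gt0 i : 0 < fib i.
Proof.
suff: (0 < fib i) && (0 < fib i.+1) by case/andP.
by elim: i => // i /andP[h1 h2]; rewrite fibSS addn_gt0 h2.
Qed.

Lemma fib_ge i : i <= fib i.
Proof.
suff: (i <= fib i) && (i.+1 <= fib i.+1) by case/andP.
elim: i => // i /andP[h1 h2]; rewrite h2 fibSS.
by rewrite -[i.+2]addn1 leq_add ?fib_gt0.
Qed.

(* The search bound [i <= x] loses nothing, since [i <= fib i]; see [is_fibP]. *)
Definition is_fib (x : nat) : bool :=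
  [exists i : 'I_x.+1, (0 < i) && (x == fib i)].

Lemma is_fibP x : reflect (exists2 i, 0 < i & x = fib i) (is_fib x).
Proof.
apply: (iffP existsP) => [[i /andP[i0 /eqP ->]]|[i i0 xE]]; first by exists i.
have ix : i < x.+1 by rewrite ltnS xE fib_ge.
by exists (Ordinal ix); rewrite /= i0 xE eqxx.
Qed.

Definition fib_partition (n : nat) (A : {fset nat}) : bool :=
  all is_fib A && (\sum_(x <- A) x == n).

(* The elements of a partition of [n] are at most [n], so restricting to subsets
   of {0, ..., n} loses nothing; see [in_fib_partitions]. *)
Definition fib_partitions (n : nat) : {fset {fset nat}} :=
  [fset A in fpowerset [fset x in iota 0 n.+1] | fib_partition n A].

Lemma in_fib_partitions n (A : {fset nat}) : (A \in fib_partitions n) = fib_partition n A.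
Proof.
rewrite !inE /= andb_idl // => /andP[_ /eqP sA].
rewrite fpowersetE; apply/fsubsetP => x xA.
have xn : x <= n by rewrite -sA (big_rem x) //= leq_addr.
by rewrite in_fset; change (x \in iota 0 n.+1); rewrite mem_iota.
Qed.

Definition F (n : nat) : nat := #|` fib_partitions n|.

(* Main.v *)
(** Put [H m = F (m - 1)] and [H 0 = 0].  Complementing subsets of
    {f_1, ..., f_k} gives [H (f_(k+1) + a) = H a + H b] whenever [a + b = f_k].
    Let [x = H a], [y = H b] and [q = f_(k+1) - f_k].  If [x^2 <= a] and
    [y^2 <= b], then [(x + y)^2 <= f_(k+1) + a] as soon as [2xy <= a + q], hence
    as soon as [4ab <= (a + q)^2].  Now [5 ((a + q)^2 - 4ab)] is a square minus
    four times the norm of [f_k - q phi] in Z[phi], phi the golden ratio; this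
    norm is 1 or -1 by Cassini, so the multiple of 5 is at least -4, hence
    nonnegative.  Equality forces [f_k = x^2 + y^2] and [q = 2xy - x^2], that is,
    [f_k - q phi = (y - x phi)^2]: then [y - x phi] is a unit, so [x], [y] and
    [x + y] are consecutive Fibonacci numbers.  Conversely
    [f_r^2 = f_(2r-1) + f_(r-2)^2] and [f_(r-2)^2 + f_(r-1)^2 = f_(2r-2)]. *)

Require Import Defs.
From mathcomp Require Import all_boot all_order all_algebra finmap zify ring.

Set Implicit Arguments.
Unset Strict Implicit.
Unset Printing Implicit Defensive.

Import Order.TTheory GRing.Theory Num.Theory.
Local Open Scope fset_scope.
Local Open Scope nat_scope.

Lemma big_fsetD (R : Type) (idx : R) (op : Monoid.com_law idx)
    (I : choiceType) (A S : {fset I}) (f : I -> R) : A `<=` S ->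
  \big[op/idx]_(i <- S) f i =
  op (\big[op/idx]_(i <- A) f i) (\big[op/idx]_(i <- S `\` A) f i).
Proof.
move=> /fsubsetP AS; rewrite (big_fsetID _ (mem A)).
congr (op _ _); apply: eq_fbigl => i; rewrite !inE /= andbC //.
by apply: andb_idr => /AS.
Qed.

Definition subset_sums (S : {fset nat}) (n : nat) : {fset {fset nat}} :=
  [fset A in fpowerset S | \sum_(x <- A) x == n].

Section SubsetSums.
Implicit Types (S A B : {fset nat}) (a n m : nat).

Lemma in_subset_sums S n A :
  (A \in subset_sums S n) = (A `<=` S) && (\sum_(x <- A) x == n).
Proof. by rewrite !inE /= fpowersetE. Qed.

Lemma subset_sums_notin a S n A :
  a \notin S -> A \in subset_sums S n -> a \notin A.
Proof.
move=> aS; rewrite in_subset_sums => /andP[/fsubsetP AS _].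
by apply: contra aS => /AS.
Qed.

Lemma subset_sumsU1 a S n : a \notin S ->
  subset_sums (a |` S) (a + n) =
  subset_sums S (a + n) `|` [fset a |` A | A in subset_sums S n].
Proof.
move=> aS; apply/fsetP => A; rewrite in_fsetU !in_subset_sums.
apply/andP/orP => [[]|[/andP[AS sumA]|/imfsetP[B /= BS ->]]].
- rewrite -fsubDset; have [aA|aA] := boolP (a \in A) => AS sumA; last first.
    by left; rewrite -[X in X `<=` _](mem_fsetD1 aA) AS.
  right; apply/imfsetP; exists (A `\ a); rewrite /= ?fsetD1K //.
  by rewrite in_subset_sums AS -(eqn_add2l a) -(big_fsetD1 a aA).
- by split=> //; apply: fsubset_trans AS (fsubsetU1 _ _).
- have aB := subset_sums_notin aS BS.
  move: BS; rewrite in_subset_sums => /andP[BS /eqP <-].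
  by rewrite fsetUS // big_fsetU1.
Qed.

Lemma card_subset_sumsU1 a S n : a \notin S ->
  #|` subset_sums (a |` S) (a + n)| =
  #|` subset_sums S (a + n)| + #|` subset_sums S n|.
Proof.
move=> aS; rewrite subset_sumsU1 // cardfsU (_ : _ `&` _ = fset0).
  rewrite cardfs0 subn0; congr addn; apply: card_in_imfset => A B /=.
  move=> /(subset_sums_notin aS) aA /(subset_sums_notin aS) aB AB.
  by rewrite -(fsetU1K aA) AB fsetU1K.
apply/eqP/fdisjointP => A /(subset_sums_notin aS) aA.
by apply: contra aA => /imfsetP[B _ ->]; rewrite fset1U1.
Qed.

Lemma card_subset_sums_eq0 S n :
  \sum_(x <- S) x < n -> #|` subset_sums S n| = 0.
Proof.
move=> Sn; apply/eqP; rewrite cardfs_eq0; apply/eqP/fsetP => A.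
rewrite in_subset_sums in_fset0; apply: contraTF Sn => /andP[AS /eqP <-].
by rewrite -leqNgt (big_fsetD _ _ AS) leq_addr.
Qed.

Lemma card_subset_sums_compl S n m : n + m = \sum_(x <- S) x ->
  #|` subset_sums S n| = #|` subset_sums S m|.
Proof.
move=> nmS; have compl A : A `<=` S ->
    (\sum_(x <- S `\` A) x == m) = (\sum_(x <- A) x == n).
  by move=> AS; move: nmS; rewrite (big_fsetD _ _ AS) /=; lia.
have -> : subset_sums S m = [fset S `\` A | A in subset_sums S n].
  apply/fsetP => B; apply/idP/imfsetP => /= [|[A + ->]].
    rewrite in_subset_sums => /andP[BS /eqP sumB].
    exists (S `\` B); last by rewrite fsetDK.
    by rewrite in_subset_sums fsubsetDl -compl ?fsubsetDl // fsetDK ?sumB /=.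
  rewrite !in_subset_sums => /andP[AS /eqP sumA].
  by rewrite fsubsetDl compl ?sumA /=.
apply/esym/card_in_imfset => A B /=; rewrite !in_subset_sums.
by move=> /andP[AS _] /andP[BS _] AB; rewrite -(fsetDK AS) AB fsetDK.
Qed.
End SubsetSums.

Lemma fib_leqS k : fib k <= fib k.+1.
Proof. by case: k => // k; rewrite fibSS leq_addr. Qed.

Lemma leq_fibS i j : (fib i.+1 <= fib j.+1) = (i <= j).
Proof.
apply: (leq_mono (f := fun i => fib i.+1)) => {i j}.
apply: homo_ltn ltn_trans _.
by move=> i; rewrite fibSS -[ltnLHS]addn0 ltn_add2l fib_gt0.
Qed.

Lemma ltn_fibS i j : (fib i.+1 < fib j.+1) = (i < j).
Proof. by rewrite !ltnNge leq_fibS. Qed.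

Lemma fib_addSS m n : fib (m + n).+2 = fib m.+1 * fib n.+1 + fib m * fib n.
Proof.
elim: m n => [|m IHm] n; first by rewrite !mul1n.
by rewrite addSnnS IHm !fibSS; ring.
Qed.

(* A number [m] with [f_(k+1) <= m <= f_(k+2)] has the form [f_(k+1) + a]. *)
Lemma fib_ind (P : nat -> Prop) : P 0 -> P 1 ->
    (forall k a b, a + b = fib k -> P a -> P b -> P (fib k.+1 + a)) ->
  forall m, P m.
Proof.
move=> P0 P1 Pstep; elim/ltn_ind => -[|[|m]] // IHm.
have lt_m k : fib k.+1 <= m.+2 -> k <= m.+2.
  by apply: leq_trans; apply: leq_trans (fib_ge k) (fib_leqS k).
have ex_k : exists k, fib k.+1 <= m.+2 by exists 0.
have [[|k] km kmax] := ex_maxnP ex_k lt_m; first by have := kmax 1 isT.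
have mk : m.+2 < fib k.+3 by rewrite ltnNge; apply/negP => /kmax; rewrite ltnn.
have := fibSS k.+1; have : fib k.+1 < fib k.+2 by rewrite ltn_fibS.
rewrite -(subnKC km) => kS fE.
apply: (Pstep k.+1 (m.+2 - fib k.+2) (fib k.+3 - m.+2)); [|apply: IHm..]; lia.
Qed.

Definition fibs_below (N : nat) : {fset nat} := [fset x in iota 0 N | is_fib x].

Lemma in_fibs_below N x : (x \in fibs_below N) = (x < N) && is_fib x.
Proof. by rewrite !inE /= mem_iota. Qed.

Lemma fibs_below1 : fibs_below (fib 1) = fset0.
Proof.
apply/fsetP => x; rewrite in_fibs_below in_fset0 ltnS leqn0.
apply/negP => /andP[/eqP-> /is_fibP[i _ fi0]].
by have := fib_gt0 i; rewrite -fi0.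
Qed.

Lemma fibs_belowS k : fibs_below (fib k.+2) = fib k.+1 |` fibs_below (fib k.+1).
Proof.
apply/fsetP => x; rewrite in_fset1U !in_fibs_below.
have [/is_fibP[[//|i] _ ->]|/is_fibP not_fib] := boolP (is_fib x).
  rewrite !andbT !ltn_fibS ltnS leq_eqVlt [fib _ == _]eqn_leq !leq_fibS.
  by rewrite -eqn_leq.
by rewrite !andbF orbF; apply/esym/eqP => xk; apply: not_fib; exists k.+1.
Qed.

Lemma sum_fibs_below k : \sum_(x <- fibs_below (fib k.+1)) x + 2 = fib k.+2.
Proof.
elim: k => [|k IHk]; first by rewrite fibs_below1 big_seq_fset0.
rewrite fibs_belowS big_fsetU1 /=; last by rewrite in_fibs_below ltnn.
by rewrite -addnA IHk addnC -fibSS.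
Qed.

Lemma F_subset_sums N n : n < N -> F n = #|` subset_sums (fibs_below N) n|.
Proof.
move=> nN; congr #|` _|; apply/fsetP => A.
rewrite in_fib_partitions in_subset_sums /fib_partition.
have [/eqP sumA|] := boolP (_ == n); rewrite ?andbT ?andbF //.
apply/allP/fsubsetP => fibA x xA; last first.
  by have := fibA x xA; rewrite in_fibs_below => /andP[].
rewrite in_fibs_below fibA // andbT (leq_ltn_trans _ nN) //.
by rewrite -sumA (big_rem x) //= leq_addr.
Qed.

Lemma F0 : F 0 = 1.
Proof.
rewrite (@F_subset_sums (fib 1)) // fibs_below1 -(cardfs1 (fset0 : {fset nat})).
congr #|` _|; apply/fsetP => A; rewrite in_subset_sums fsubset0 in_fset1.
by apply: andb_idr => /eqP->; rewrite big_seq_fset0.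
Qed.

(* The shift, with value 0 at 0, makes [Fpred_fibD] and [Fpred_sqr_le]
   homogeneous. *)
Definition Fpred (m : nat) : nat := if m is n.+1 then F n else 0.

Lemma card_subset_sums_fibs_below k n m :
    n + m + 1 = fib k.+2 -> m <= fib k.+1 ->
  #|` subset_sums (fibs_below (fib k.+1)) n| = Fpred m.
Proof.
have := sum_fibs_below k; case: m => [|m] sumE nmE mk.
  by apply: card_subset_sums_eq0; lia.
by rewrite [RHS](F_subset_sums mk); apply: card_subset_sums_compl; lia.
Qed.

Lemma Fpred_fibD k a b :
  a + b = fib k -> Fpred (fib k.+1 + a) = Fpred a + Fpred b.
Proof.
move=> abk.
have fkS := fib_leqS k; have fk0 := fib_gt0 k.+1; have fE := fibSS k.
have card_b n : n + b + 1 = fib k.+2 ->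
    #|` subset_sums (fibs_below (fib k.+1)) n| = Fpred b.
  by move=> nb; apply: card_subset_sums_fibs_below => //; lia.
case: a abk => [|a] abk.
  rewrite addn0 -(prednK fk0) [LHS](@F_subset_sums (fib k.+1)) ?prednK //.
  by apply: card_b; lia.
rewrite addnS [LHS](@F_subset_sums (fib k.+2)); last lia.
rewrite fibs_belowS card_subset_sumsU1; last by rewrite in_fibs_below ltnn.
rewrite card_b; last lia.
by rewrite addnC; congr addn; apply/esym/F_subset_sums; lia.
Qed.

Lemma Fpred_fib_sqr r : Fpred (fib r ^ 2) = fib r.
Proof.
suff [] : Fpred (fib r ^ 2) = fib r /\ Fpred (fib r.+1 ^ 2) = fib r.+1 by [].
elim: r => [|r [IHr IHrS]]; first by rewrite /= F0.
split=> //; have -> : fib r.+2 ^ 2 = fib (r.+1 + r).+2 + fib r ^ 2.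
  by rewrite fib_addSS !fibSS; ring.
rewrite (@Fpred_fibD (r.+1 + r).+1 _ (fib r.+1 ^ 2)).
  by rewrite IHr IHrS addnC.
by rewrite addnC addSn fib_addSS !mulnn.
Qed.

Local Open Scope ring_scope.

(* The norm of [x - y phi] in Z[phi], where [phi ^ 2 = phi + 1]. *)
Definition golden_norm (R : pzRingType) (x y : R) : R :=
  x ^+ 2 - x * y - y ^+ 2.

Section GoldenNorm.
Variable R : comPzRingType.
Implicit Types x y : R.

Lemma golden_normD x y : golden_norm (x + y) x = - golden_norm x y.
Proof. by rewrite /golden_norm; ring. Qed.

Lemma golden_norm_sqr x y :
  golden_norm (x ^+ 2 + y ^+ 2) (2 * x * y - y ^+ 2) = golden_norm x y ^+ 2.
Proof. by rewrite /golden_norm; ring. Qed.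

Lemma golden_norm_fib k :
  golden_norm (fib k)%:R ((fib k.+1)%:R - (fib k)%:R) = (-1) ^+ k :> R.
Proof.
elim: k => [|k IHk]; first by rewrite /golden_norm /=; ring.
have -> : (fib k.+2)%:R - (fib k.+1)%:R = (fib k)%:R :> R.
  by rewrite fibSS natrD addrC addKr.
rewrite -[X in golden_norm X](subrKC (fib k)%:R) golden_normD.
by rewrite IHk exprS mulN1r.
Qed.
End GoldenNorm.

Lemma fib_of_golden_norm (x y : nat) : (0 < x)%N ->
    golden_norm x%:Z y%:Z ^+ 2 = 1 ->
  exists r, x = fib r /\ (x + y)%N = fib r.+1.
Proof.
have [n] := ubnP (x + y)%N; elim: n => // n IHn in x y *.
move=> lt_xyn x0 norm1; have [y0|y0] := posnP y.
  by exists 0%N; move: norm1; rewrite /golden_norm y0 => norm1; split=> /=; nia.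
have yx : (y <= x)%N.
  by rewrite leqNgt; apply/negP => xy; move: norm1; rewrite /golden_norm; nia.
have xE : x%:Z = y%:Z + (x - y)%N%:Z by lia.
have [||r [yr xr]] := IHn y (x - y)%N _ y0.
- by lia.
- by rewrite -norm1 [in RHS]xE golden_normD sqrrN.
by exists r.+1; rewrite fibSS -xr -yr; split; lia.
Qed.

Lemma four_mul_le_sqr_golden (a b q : int) :
  golden_norm (a + b) q <= 1 -> 4 * a * b <= (a + q) ^+ 2.
Proof.
(* The left-hand side below is a multiple of 5 that is at least -4. *)
have : 5 * ((a + q) ^+ 2 - 4 * a * b) =
    (5 * a - 2 * (a + b) + q) ^+ 2 - 4 * golden_norm (a + b) q.
  by rewrite /golden_norm; ring.
by have := sqr_ge0 (5 * a - 2 * (a + b) + q); lia.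
Qed.

Lemma two_mul_le_of_sqr (R : realDomainType) (a b c x y : R) :
    4 * a * b <= c ^+ 2 -> 0 <= c -> x ^+ 2 <= a -> y ^+ 2 <= b ->
  2 * x * y <= c.
Proof.
move=> abc c0 xa yb; apply: le_trans (ler_norm _) _.
rewrite -ler_sqr ?nnegrE // real_normK ?num_real //; apply: le_trans abc.
have -> : (2 * x * y) ^+ 2 = 4 * (x ^+ 2 * y ^+ 2) by ring.
by rewrite -mulrA ler_pM2l // ler_pM ?sqr_ge0.
Qed.

Lemma two_mul_fib_le k (a b x y : nat) :
    (a + b)%N = fib k -> (x ^ 2 <= a)%N -> (y ^ 2 <= b)%N ->
  (2 * x * y + fib k <= fib k.+1 + a)%N.
Proof.
move=> abk xa yb; have fkS := fib_leqS k.
suff : 2 * x%:Z * y%:Z <= a%:Z + ((fib k.+1)%:Z - (fib k)%:Z) by lia.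
apply: (@two_mul_le_of_sqr _ a%:Z b%:Z); [|lia..].
apply: four_mul_le_sqr_golden; rewrite -PoszD abk -!natz golden_norm_fib.
by rewrite -signr_odd; case: odd.
Qed.

Lemma sqr_addn_fib_le k (a b x y : nat) :
    (a + b)%N = fib k -> (x ^ 2 <= a)%N -> (y ^ 2 <= b)%N ->
  ((x + y) ^ 2 <= fib k.+1 + a)%N.
Proof.
by move=> abk xa yb; have := two_mul_fib_le abk xa yb; rewrite sqrnD; lia.
Qed.

Lemma fib_of_sqr_addn_eq k (a b x y : nat) :
    (a + b)%N = fib k -> (x ^ 2 <= a)%N -> (y ^ 2 <= b)%N ->
    ((x + y) ^ 2)%N = (fib k.+1 + a)%N ->
  exists r, (x + y)%N = fib r.
Proof.
move=> abk xa yb; have le2xy := two_mul_fib_le abk xa yb.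
have fk0 := fib_gt0 k.+1; rewrite sqrnD => xyE.
have y0 : (0 < y)%N by rewrite lt0n; apply/eqP => y0; rewrite y0 in xyE; lia.
have PE : (fib k)%:R = y%:Z ^+ 2 + x%:Z ^+ 2 by lia.
have qE : (fib k.+1)%:R - (fib k)%:R = 2 * y%:Z * x%:Z - x%:Z ^+ 2 by lia.
have normE : golden_norm y%:Z x%:Z ^+ 2 = (-1) ^+ k.
  by rewrite -golden_norm_sqr -PE -qE golden_norm_fib.
have [|r [_ xyr]] := fib_of_golden_norm (x := y) (y := x) y0.
  by rewrite -[LHS]ger0_norm ?sqr_ge0 // normE normr_sign.
by exists r.+1; rewrite addnC.
Qed.

Lemma Fpred_sqr_le m : (Fpred m ^ 2 <= m)%N.
Proof.
elim/fib_ind: m => [||k a b abk IHa IHb] //; first by rewrite /= F0.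
by rewrite (Fpred_fibD abk) (sqr_addn_fib_le abk).
Qed.

Lemma Fpred_sqr_eq_fib m :
  (0 < m)%N -> (Fpred m ^ 2)%N = m -> exists r, Fpred m = fib r.
Proof.
elim/fib_ind: m => [||k a b abk _ _ _] //; first by exists 0%N; rewrite /= F0.
rewrite (Fpred_fibD abk).
by apply: fib_of_sqr_addn_eq abk _ _; apply: Fpred_sqr_le.
Qed.

Theorem theorem4p5 (R : rcfType) (n : nat) :
  (F n)%:R <= Num.sqrt (n%:R + 1) :> R /\
  ((F n)%:R = Num.sqrt (n%:R + 1) :> R <->
   exists r : nat, n = (fib r ^ 2 - 1)%N).
Proof.
have -> : (F n)%:R = Num.sqrt (F n ^ 2)%:R :> R.
  by rewrite natrX sqrtr_sqr ger0_norm.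
rewrite natr1 ler_sqrt ?ler0n // ler_nat; split; first exact: Fpred_sqr_le n.+1.
split=> [/eqP|[r nE]].
  rewrite eqr_sqrt ?ler0n // eqr_nat => /eqP FE.
  have [|r /= Fr] := @Fpred_sqr_eq_fib n.+1 isT; first exact: FE.
  by exists r; rewrite -Fr FE subn1.
have n1E : n.+1 = (fib r ^ 2)%N by rewrite nE subn1 prednK ?expn_gt0 ?fib_gt0.
by rewrite n1E -(Fpred_fib_sqr r) -n1E.
Qed.
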